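(* Let $F$ be a distribution function on $\mathbb{R}$ with $F(x)<1$ for all $x$, and suppose that for some $x_0\ge 0$ one of the following two representations holds for all $x\ge x_0$: (i) $1-F(x)=c(x)\exp\left\{-\int_{x_0}^{x}\frac{1}{f(t)}\,dt\right\}$, or (ii) $1-F(x)=c(x)\exp\left\{-\int_{x_0}^{x}\frac{g(t)}{f(t)}\,dt\right\}$, where $f$ is positive and absolutely continuous on $[x_0,\infty)$ with density $f'$ satisfying $f'(x)\to 0$ as $x\to\infty$, $c(x)\to c>0$ as $x\to\infty$, and (in case (ii)) $g(x)\to 1$ as $x\to\infty$. Let $X_1,X_2,\dots$ be i.i.d. random variables with distribution function $F$ and $M_n=\max(X_1,\dots,X_n)$. Let $b_n=F^{\leftarrow}(1-n^{-1})$, and let $a_n=f(b_n)$ in case (i), $a_n=f(b_n)/g(b_n)$ in case (ii). Define, in case (i), $$\gamma_n(x)=\int_{b_n}^{a_nx+b_n}\left(\frac{1}{f(t)}-\frac{1}{f(b_n)}\right)dt-\log\frac{c(a_nx+b_n)}{c(b_n)}+x,$$ and in case (ii) $$\gamma_n(x)=\int_{b_n}^{a_nx+b_n}\left(\frac{g(t)}{f(t)}-\frac{g(b_n)}{f(b_n)}\right)dt-\log\frac{c(a_nx+b_n)}{c(b_n)}+x.$$ Then for any $x\in\mathbb{R}$, $$P(M_n\le a_nx+b_n)-\exp\left(-e^{-x}\right)=\exp\left(-e^{-x}\right)e^{-x}\,(\gamma_n(x)-x)(1+o(1))+O(n^{-1}),\qquad n\to\infty.$$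
   Context: $F^{\leftarrow}(y)=\inf\{x: F(x)\ge y\}$ is the generalized inverse. The numbers $b_n$ are taken to satisfy $1-F(b_n)=1/n$, i.e. $\int_{x_0}^{b_n}\frac{1}{f(t)}dt=\log(n\,c(b_n))$ in case (i) and $\int_{x_0}^{b_n}\frac{g(t)}{f(t)}dt=\log(n\,c(b_n))$ in case (ii). For fixed $x$ all quantities are considered for $n$ large enough that $b_n>x_0$, $a_nx+b_n>x_0$ and $g(b_n)>0$. *)

(* Defs.v *)
(* All integrals are Lebesgue integrals on R. *)
From HB Require Import structures.
From mathcomp Require Export all_boot all_order all_algebra finmap.
From mathcomp Require Export all_classical all_reals all_analysis.
Export Order.TTheory GRing.Theory Num.Theory.
Export numFieldNormedType.Exports.
Set Implicit Arguments.
Unset Strict Implicit.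
Unset Printing Implicit Defensive.
Local Open Scope classical_set_scope.
Local Open Scope ring_scope.

(* Meant for 0 < y < 1 and F a distribution function: the set is then nonempty
   and bounded below, so the total function inf is its genuine infimum. *)
Definition ginv (R : realType) (F : R -> R) (y : R) : R :=
  inf [set x | y <= F x].

(* Oriented integral: bounds such as b_n and a_n x + b_n are in reversed order
   when x < 0. *)
Definition oint (R : realType) (a b : R) (h : R -> R) : R :=
  if a <= b then \int[lebesgue_measure]_(t in `[a, b]) h t
  else - \int[lebesgue_measure]_(t in `[b, a]) h t.

Definition locally_integrable_from (R : realType) (x0 : R) (h : R -> R) : Prop :=
  forall x, x0 <= x ->
    (@lebesgue_measure R).-integrable `[x0, x] (EFin \o h).

Definition abs_continuous_with_density (R : realType) (x0 : R)
    (f f' : R -> R) : Prop :=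
  locally_integrable_from x0 f' /\
  forall x, x0 <= x -> f x = f x0 + oint x0 x f'.

(* 1 - F(x) = c(x) exp(- \int_{x0}^x h(t) dt) for x >= x0, where h = 1 / f or
   h = g / f; the local integrability of h is what gives the integral its
   meaning. *)
Definition tail_representation (R : realType) (F : R -> R) (x0 : R)
    (c h : R -> R) : Prop :=
  locally_integrable_from x0 h /\
  forall x, x0 <= x -> 1 - F x = c x * expR (- oint x0 x h).

Definition gamma_ (R : realType) (c h : R -> R) (a b : R^nat)
    (n : nat) (x : R) : R :=
  oint (b n) (a n * x + b n) (fun t => h t - h (b n))
  - ln (c (a n * x + b n) / c (b n)) + x.

Section random_sequence.
Context d (T : measurableType d) (R : realType) (P : probability T R).

Definition mutually_independent (X : nat -> {RV P >-> R}) : Prop :=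
  forall (J : {fset nat}) (A : nat -> set R),
    (forall i, measurable (A i)) ->
    P (\bigcap_(i in [set` J]) (X i @^-1` A i)) =
    (\prod_(i <- J) P (X i @^-1` A i))%E.

Definition iid_with_df (X : nat -> {RV P >-> R}) (F : R -> R) : Prop :=
  mutually_independent X /\ forall i r, cdf (X i) r = (F r)%:E.

(* The variables are indexed from 0, so that this is the maximum of the first
   n of them for n >= 1; the value at n = 0 is irrelevant to the asymptotics. *)
Definition running_max (X : nat -> {RV P >-> R}) (n : nat) (w : T) : R :=
  \big[Num.max/X 0%N w]_(i < n) X i w.

(* P(M_n <= a_n x + b_n) - exp(-e^{-x})
     = exp(-e^{-x}) e^{-x} (gam_n(x) - x) (1 + o(1)) + O(1/n)
   for fixed x: eps is the o(1) and rho the O(1/n). *)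
Definition gumbel_expansion (X : nat -> {RV P >-> R}) (a b : R^nat)
    (gam : nat -> R -> R) (x : R) : Prop :=
  exists eps rho : R^nat,
    [/\ eps =o_\oo (fun=> 1 : R),
        rho =O_\oo (fun n => n%:R^-1 : R)
      & \forall n \near \oo,
          fine (P [set w | running_max X n w <= a n * x + b n])
            - expR (- expR (- x))
          = expR (- expR (- x)) * expR (- x) * (gam n x - x) * (1 + eps n)
            + rho n].

End random_sequence.

(* Main.v *)
Require Import Defs.
From mathcomp Require Import ring lra.
Set Implicit Arguments.
Unset Strict Implicit.
Unset Printing Implicit Defensive.
Local Open Scope classical_set_scope.
Local Open Scope ring_scope.

(** Write y_n = a_n x + b_n. The whole expansion rests on one exact identity:
    since a_n is the reciprocal of the hazard rate h = g / f at b_n, the terms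
    x in gamma_n(x) cancel and the tail representation gives
      n (1 - F(y_n)) = exp(- gamma_n(x))
    ([tail_ratio_gamma]). As P(M_n <= y_n) = F(y_n)^n by independence
    ([measure_running_max_le]),
      P(M_n <= y_n) = (1 - exp(- gamma_n(x)) / n)^n.
    Two approximations then remain, each elementary once gamma_n(x) --> x.
    Replacing the power by exp(- exp(- gamma_n(x))) costs t^2 / n with
    t = exp(- gamma_n(x)) bounded, which is the O(1/n) term
    ([normr_onem_divX_expRN]). Replacing gamma_n(x) by x in the Gumbel
    distribution function exp(- exp(- t)) is a first-order Taylor expansion,
    whose relative error is the 1 + o(1) factor ([first_order_expansion]).

    The convergence gamma_n(x) --> x ([gamma_cvg]) is the asymptotic content.
    Because f' --> 0, f has arbitrarily small Lipschitz constants near infinity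
    ([lipschitz_at_infinity]). Hence f(t) = o(t), so that y_n goes to infinity
    with b_n ([normalization_cvg_pinfty]); and f varies by a vanishing fraction
    of f(b_n) between b_n and y_n, whose distance is of order f(b_n). As g --> 1,
    the hazard rate has the same property, and its integrated increment vanishes
    ([hazard_increment_cvg0]). The logarithmic term vanishes as c converges to a
    positive limit.

    The representation by 1 / f is the one by g / f with g = 1. *)

(** * Oriented integrals *)

Lemma integrable_cst_itv (R : realType) (u v k : R) :
  (@lebesgue_measure R).-integrable `[u, v] (EFin \o cst k).
Proof.
apply: continuous_compact_integrable; first exact: segment_compact.
exact/continuous_subspaceT/cst_continuous.
Qed.

Lemma loc_integrable_itv (R : realType) (x0 u v : R) (h : R -> R) :
  locally_integrable_from x0 h -> x0 <= u ->
  (@lebesgue_measure R).-integrable `[u, v] (EFin \o h).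
Proof.
move=> hI ux0; have [uv|vu] := leP u v.
- apply: integrableS (hI v (le_trans ux0 uv)) => //.
  by apply: subset_itvr; rewrite bnd_simp.
- rewrite set_itv_ge ?bnd_simp -?ltNge//; exact: integrable_set0.
Qed.

(** Everything is measured from the base point of the integrability hypothesis,
    so that u and v may come in either order. *)
Lemma oint_chasles (R : realType) (x0 u v : R) (h : R -> R) :
  locally_integrable_from x0 h -> x0 <= u -> x0 <= v ->
  oint u v h = oint x0 v h - oint x0 u h.
Proof.
move=> hI.
have base a b : x0 <= a -> a <= b ->
    \int[lebesgue_measure]_(t in `[a, b]) h t = oint x0 b h - oint x0 a h.
  move=> xa ab; rewrite /oint xa (le_trans xa ab).
  rewrite Rintegral_itvB ?bnd_simp//; last exact/hI/(le_trans xa).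
  rewrite Rintegral_itv_obnd_cbnd//.
  apply: integrableS (loc_integrable_itv b hI xa) => //.
  by apply: subset_itvr; rewrite bnd_simp.
move=> xu xv; rewrite {1}/oint; have [uv|vu] := leP u v; first exact: base.
by rewrite base ?(ltW vu)// opprB.
Qed.

Lemma le_normr_oint (R : realType) (x0 u v M : R) (h : R -> R) :
  locally_integrable_from x0 h -> x0 <= u -> x0 <= v ->
  (forall t, Num.min u v <= t -> t <= Num.max u v -> `|h t| <= M) ->
  `|oint u v h| <= M * `|v - u|.
Proof.
move=> hI.
have base a b : x0 <= a -> a <= b -> (forall t, a <= t -> t <= b -> `|h t| <= M) ->
    `|\int[lebesgue_measure]_(t in `[a, b]) h t| <= M * (b - a).
  move=> xa ab hM.
  have hab := loc_integrable_itv b hI xa.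
  apply: (le_trans (le_normr_Rintegral _ hab)) => //.
  have -> : M * (b - a) = \int[@lebesgue_measure R]_(t in `[a, b]) M.
    rewrite Rintegral_cst//= lebesgue_measure_itv/= lte_fin.
    by case: ltgtP ab => // -> _; rewrite subrr.
  apply: le_Rintegral => //.
  - exact: (integrable_norm hab).
  - exact: integrable_cst_itv.
  by move=> t /=; rewrite in_itv/= => /andP[]; exact: hM.
move=> xu xv; rewrite /oint; have [uv|vu] := leP u v => hM.
  by rewrite (ger0_norm (x := v - u)) ?subr_ge0//; apply: base.
rewrite normrN distrC (ger0_norm (x := u - v)) ?subr_ge0 ?(ltW vu)//.
exact: base (ltW vu) _.
Qed.

Lemma loc_integrable_subr_cst (R : realType) (x0 k : R) (h : R -> R) :
  locally_integrable_from x0 h ->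
  locally_integrable_from x0 (fun t => h t - k).
Proof.
move=> hI x xx.
exact: (integrableB _ (hI _ xx) (integrable_cst_itv x0 x k)).
Qed.

Lemma oint_subr_cst (R : realType) (x0 u v k : R) (h : R -> R) :
  locally_integrable_from x0 h -> x0 <= u -> x0 <= v ->
  oint u v (fun t => h t - k) = oint u v h - k * (v - u).
Proof.
move=> hI.
have base a b : x0 <= a -> a <= b ->
    \int[lebesgue_measure]_(t in `[a, b]) (h t - k) =
    \int[lebesgue_measure]_(t in `[a, b]) h t - k * (b - a).
  move=> xa ab; rewrite RintegralB//; last 2 first.
  - exact: loc_integrable_itv hI xa.
  - exact: integrable_cst_itv.
  congr (_ - _).
  rewrite Rintegral_cst//= lebesgue_measure_itv/= lte_fin.
  by case: ltgtP ab => // -> _; rewrite subrr.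
move=> xu xv; rewrite /oint; have [uv|vu] := leP u v; first exact: base.
rewrite base ?(ltW vu)//; ring.
Qed.

(** * The law of the maximum *)

(** The event is the intersection of the events X_i <= y over i < n, to which
    the product rule applies. *)
Lemma measure_running_max_le d (T : measurableType d) (R : realType)
    (P : probability T R) (X : nat -> {RV P >-> R}) (F : R -> R) (n : nat) (y : R) :
  iid_with_df X F -> (0 < n)%N ->
  fine (P [set w | running_max X n w <= y]) = F y ^+ n.
Proof.
move=> [indep df] n0.
pose J : {fset nat} := seq_fset tt (iota 0 n).
have -> : [set w | running_max X n w <= y] =
    \bigcap_(i in [set` J]) (X i @^-1` `]-oo, y]).
  apply/seteqP; split => w /=.
    move=> /bigmax_leP[_ Xy] i /=; rewrite seq_fsetE mem_iota add0n => /= lt_in.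
    by rewrite in_itv/=; exact: (Xy (Ordinal lt_in)).
  move=> Xy.
  have Xle i : (i < n)%N -> X i w <= y.
    move=> lt_in; have := Xy i.
    by rewrite /= seq_fsetE mem_iota add0n lt_in in_itv/=; apply.
  by apply/bigmax_leP; split => [|i _]; exact: Xle.
rewrite (indep J (fun=> `]-oo, y]%classic))//.
rewrite (eq_bigr (fun=> (F y)%:E)) => [|i _]; last exact: df.
rewrite prodEFin/=.
rewrite big_const_seq count_predT iter_mulr_1; congr (_ ^+ _).
by rewrite [size _](size_seq_fset tt (iota 0 n)) undup_id ?iota_uniq// size_iota.
Qed.

(** * Elementary approximations *)

(** The bound exp u >= 1 + u suffices, because
    (1 - u + u^2) (1 + u) = 1 + u^3 >= 1. *)
Lemma expRN_le (R : realType) (u : R) : 0 <= u -> expR (- u) <= 1 - u + u ^+ 2.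
Proof.
move=> u0; rewrite expRN.
have e0 : 0 < expR u := expR_gt0 u.
rewrite -[leLHS]mul1r ler_pdivrMr//.
apply: (@le_trans _ _ ((1 - u + u ^+ 2) * (1 + u))).
  have -> : (1 - u + u ^+ 2) * (1 + u) = 1 + u ^+ 3 by ring.
  by rewrite lerDl exprn_ge0.
apply: ler_wpM2l; last exact: expR_ge1Dx.
nra.
Qed.

(** Factoring out a - b leaves a sum of n monomials in a and b, each at most 1. *)
Lemma normr_subX_le (R : realDomainType) (a b : R) (n : nat) :
  0 <= a <= 1 -> 0 <= b <= 1 -> `|a ^+ n - b ^+ n| <= n%:R * `|a - b|.
Proof.
move=> /andP[a0 a1] /andP[b0 b1].
rewrite subrXX normrM mulrC; apply: ler_wpM2r => //.
apply: le_trans (ler_norm_sum _ _ _) _.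
rewrite -[leRHS](_ : \sum_(i < n) 1 = _); last by rewrite sumr_const card_ord.
apply: ler_sum => i _.
by rewrite normrM !normrX !ger0_norm// mulr_ile1 ?exprn_ge0// exprn_ile1.
Qed.

(** With u = t / n, both terms are n-th powers, of 1 - u and exp(- u), two
    numbers of the unit interval at distance at most u^2. *)
Lemma normr_onem_divX_expRN (R : realType) (t : R) (n : nat) :
  (0 < n)%N -> 0 <= t <= n%:R ->
  `|(1 - t / n%:R) ^+ n - expR (- t)| <= t ^+ 2 / n%:R.
Proof.
move=> n0 /andP[t0 tn].
have nR : 0 < n%:R :> R by rewrite ltr0n.
have u0 : 0 <= t / n%:R by rewrite divr_ge0// ltW.
have u1 : t / n%:R <= 1 by rewrite ler_pdivrMr// mul1r.
have -> : expR (- t) = expR (- (t / n%:R)) ^+ n.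
  by rewrite -expRM_natl mulrN mulrCA divff ?mulr1// gt_eqF.
apply: (le_trans (normr_subX_le n _ _)).
- by apply/andP; split; lra.
- by rewrite expR_ge0/= -[leRHS]expR0 ler_expR oppr_le0.
have -> : t ^+ 2 / n%:R = n%:R * (t / n%:R) ^+ 2 by field; rewrite gt_eqF.
apply: ler_wpM2l; first exact: ltW.
have := expR_ge1Dx (- (t / n%:R)); have := expRN_le u0.
move=> h1 h2; rewrite ler_norml; apply/andP; split; lra.
Qed.

(** The relative error eps_n is the difference quotient over dG, minus 1. It is
    set to 0 when u_n = x, where the quotient has no meaning and the expansion
    holds trivially; this makes the identity valid for every n. *)
Lemma first_order_expansion (R : realType) (G : R -> R) (x dG : R) (u : R^nat) :
  is_derive x 1 G dG -> dG != 0 -> u n @[n --> \oo] --> x ->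
  exists2 eps : R^nat, eps =o_\oo (fun=> 1 : R) &
    forall n, G (u n) - G x = dG * (u n - x) * (1 + eps n).
Proof.
move=> GdG dG0 ux.
exists (fun n => if u n == x then 0 else (G (u n) - G x) / (u n - x) / dG - 1).
  apply/eqoP => e e0.
  have quot : h^-1 *: (G (h *: 1 + x) - G x) @[h --> 0^'] --> dG.
    by rewrite -(@derive_val _ _ _ _ _ _ _ GdG); apply: (@ex_derive _ _ _ _ _ _ _ GdG).
  have ed : 0 < e * `|dG| by rewrite mulr_gt0// normr_gt0.
  move/cvgrPdist_le : quot => /(_ _ ed).
  rewrite /dnbhs /within/= => /nbhs_ballP[r /= r0 rP].
  move/cvgrPdist_lt : ux => /(_ _ r0); apply: filter_app; near=> n => xun.
  rewrite normr1 mulr1; case: eqP => [_|/eqP un]; first by rewrite normr0 ltW.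
  have h0 : u n - x != 0 by rewrite subr_eq0.
  have := rP (u n - x); rewrite /ball/= sub0r normrN distrC => /(_ xun h0).
  rewrite scaler1 addrNK -[_ *: _]/(_ * _) => H.
  have -> : (G (u n) - G x) / (u n - x) / dG - 1 =
     - ((dG - (u n - x)^-1 * (G (u n) - G x)) / dG) by field; rewrite dG0 h0.
  by rewrite normrN normrM normfV ler_pdivrMr// normr_gt0.
move=> n; case: eqP => [->|/eqP un]; first by rewrite !subrr mulr0 mul0r.
by field; rewrite dG0 subr_eq0 un.
Unshelve. all: by end_near. Qed.

Lemma is_derive_gumbel (R : realType) (x : R) :
  is_derive x 1 (fun t => expR (- expR (- t))) (expR (- expR (- x)) * expR (- x)).
Proof.
apply: is_derive_eq.
ring.
Qed.

(** * Asymptotics of the hazard rate *)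

(** The increment of f is the integral of f', eventually smaller than e. *)
Lemma lipschitz_at_infinity (R : realType) (x0 : R) (f f' : R -> R) (e : R) :
  abs_continuous_with_density x0 f f' -> f' x @[x --> +oo] --> (0 : R) -> 0 < e ->
  \forall A \near +oo, forall s t, A <= s -> A <= t -> `|f t - f s| <= e * `|t - s|.
Proof.
move=> [f'I fE] f'0 e0.
have [B [_ f'B]] : \forall x \near +oo, `|f' x| < e.
  by move/cvgrPdist_lt : f'0 => /(_ _ e0); apply: filterS => x; rewrite sub0r normrN.
near=> A => s t As At.
have BA : B < A by near: A; apply: nbhs_pinfty_gt; exact: num_real.
have xA : x0 <= A by near: A; apply: nbhs_pinfty_ge; exact: num_real.
have xs := le_trans xA As; have xt := le_trans xA At.
have -> : f t - f s = oint s t f'.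
  by rewrite (oint_chasles f'I xs xt) (fE t)// (fE s)//; ring.
apply: le_normr_oint f'I xs xt _ => r sr _; apply/ltW/f'B.
by apply: (lt_le_trans BA); apply: le_trans sr; rewrite le_min As At.
Unshelve. all: by end_near. Qed.

(** Eventually g(u_n) > 1/2, and f(u_n) <= C + e u_n with e as small as desired,
    so the displacement f(u_n) / g(u_n) x is at most u_n / 2 plus a constant. *)
Lemma normalization_cvg_pinfty (R : realType) (x0 : R) (f f' g : R -> R)
    (x : R) (u : R^nat) :
  abs_continuous_with_density x0 f f' -> f' x @[x --> +oo] --> (0 : R) ->
  (forall x, x0 <= x -> 0 < f x) -> g x @[x --> +oo] --> (1 : R) ->
  u n @[n --> \oo] --> +oo ->
  f (u n) / g (u n) * x + u n @[n --> \oo] --> +oo.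
Proof.
move=> fac f'0 f0 g1 uy.
(* Chosen so that 2 |x| e <= 1/2, which leaves at least half of u_n. *)
pose e := (4 * (`|x| + 1))^-1.
have x1 : 0 < `|x| + 1 by rewrite ltr_wpDl.
have e0 : 0 < e by rewrite invr_gt0 mulr_gt0.
have [A [_ fA]] := lipschitz_at_infinity fac f'0 e0.
(* A bounds a neighbourhood of infinity strictly, hence A + 1. *)
pose A' := Num.max (A + 1) (Num.max x0 0).
have lipA' : forall s t, A' <= s -> A' <= t -> `|f t - f s| <= e * `|t - s|.
  by apply: fA; rewrite lt_max ltrDl ltr01.
apply/cvgryPge => M.
have gu : g (u n) @[n --> \oo] --> (1 : R) by apply: (cvg_comp _ _ uy g1).
near=> n.
have un : A' <= u n by near: n; exact: (cvgry_ge uy).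
have g2 : 2^-1 < g (u n).
  by near: n; apply: (cvgr_gt _ gu); rewrite invf_lt1// ltr1n.
have uM : 2 * (M + 2 * `|x| * f A') <= u n by near: n; exact: (cvgry_ge uy).
have x0A : x0 <= A' by rewrite /A' !le_max lexx orbT.
have A0 : 0 <= A' by rewrite /A' !le_max lexx !orbT.
have fu : 0 < f (u n) by apply: f0; exact: le_trans un.
have g0 : 0 < g (u n) by apply: lt_trans g2.
have ub : f (u n) <= f A' + e * u n.
  have := lipA' _ _ (lexx A') un.
  rewrite (ger0_norm (x := u n - A')) ?subr_ge0// => /ler_normlP[_ H].
  by rewrite mulrBr in H; have := mulr_ge0 (ltW e0) A0; lra.
have ax : `|f (u n) / g (u n) * x| <= 2 * f (u n) * `|x|.
  rewrite normrM; apply: ler_wpM2r => //.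
  rewrite gtr0_norm ?divr_gt0// ler_pdivrMr// mulrC.
  nra.
have ex : e * `|x| <= 4^-1.
  by rewrite /e mulrC ler_pdivrMr ?mulr_gt0//; lra.
have exu : e * `|x| * u n <= 4^-1 * u n.
  by apply: ler_wpM2r => //; exact: le_trans un.
have fux := ler_wpM2r (normr_ge0 x) ub.
have := ler_normlP _ _ ax => -[H _].
nra.
Unshelve. all: by end_near. Qed.

(** The points t between u_n and y_n = a x + u_n are at distance at most a |x|
    from u_n, where a = f(u_n) / g(u_n) <= 2 f(u_n). The small Lipschitz constant
    of f therefore makes f(t) close to f(u_n) relatively to f(u_n), and h = g / f
    close to h(u_n) = 1 / a relatively to 1 / a. Integrating a discrepancy of
    order del / a over a length a |x| leaves O(del). *)
Lemma hazard_increment_cvg0 (R : realType) (x0 : R) (f f' g : R -> R)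
    (x : R) (u : R^nat) :
  abs_continuous_with_density x0 f f' -> f' x @[x --> +oo] --> (0 : R) ->
  (forall x, x0 <= x -> 0 < f x) -> g x @[x --> +oo] --> (1 : R) ->
  locally_integrable_from x0 (fun t => g t / f t) ->
  u n @[n --> \oo] --> +oo ->
  oint (u n) (f (u n) / g (u n) * x + u n)
    (fun t => g t / f t - g (u n) / f (u n)) @[n --> \oo] --> (0 : R).
Proof.
move=> fac f'0 f0 g1 hI uy; apply/cvgrPdist_le => e e0.
have yy := normalization_cvg_pinfty x fac f'0 f0 g1 uy.
have x1 : 0 < `|x| + 1 by rewrite ltr_wpDl.
(* The estimates below give the bound 16 del |x| for the integral; del <= 1/2
   keeps g(u_n) f(t) above f(u_n) / 4. *)
pose del := Num.min 2^-1 (e / (16 * (`|x| + 1))).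
have del0 : 0 < del by rewrite lt_min invr_gt0 ltr0n /= divr_gt0// mulr_gt0.
have del2 : del <= 2^-1 by rewrite ge_min lexx.
have del16 : 16 * del * `|x| <= e.
  have : del * (16 * (`|x| + 1)) <= e.
    by rewrite -ler_pdivlMr ?mulr_gt0// ge_min lexx orbT.
  by nra.
(* As |t - u_n| <= 2 f(u_n) |x|, this Lipschitz constant yields
   |f(t) - f(u_n)| <= del f(u_n). *)
pose del' := del / (2 * (`|x| + 1)).
have del'0 : 0 < del' by rewrite divr_gt0// mulr_gt0.
have [A [_ fA]] := lipschitz_at_infinity fac f'0 del'0.
have [B [_ gB]] : \forall x \near +oo, `|1 - g x| < del by move/cvgrPdist_lt : g1; apply.
pose A' := Num.max (A + 1) (Num.max x0 (B + 1)).
have x0A : x0 <= A' by rewrite /A' !le_max lexx orbT.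
have lipA' : forall s t, A' <= s -> A' <= t -> `|f t - f s| <= del' * `|t - s|.
  by apply: fA; rewrite lt_max ltrDl ltr01.
have gA' t : A' <= t -> `|1 - g t| < del.
  by move=> At; apply: gB; apply: lt_le_trans At; rewrite !lt_max !ltrDl ltr01 !orbT.
near=> n.
have un : A' <= u n by near: n; exact: (cvgry_ge uy).
have yn : A' <= f (u n) / g (u n) * x + u n by near: n; exact: (cvgry_ge yy).
rewrite sub0r normrN.
have fu : 0 < f (u n) by apply: f0; exact: le_trans un.
have gu := gA' _ un; move/ltr_normlP: (gu) => [gu1 gu2].
have gu0 : 0 < g (u n) by lra.
set a := f (u n) / g (u n) in yn *.
have a0 : 0 < a by rewrite divr_gt0.
have a2 : a <= 2 * f (u n) by rewrite ler_pdivrMr//; nra.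
have xu := le_trans x0A un; have xy := le_trans x0A yn.
have hJ := loc_integrable_subr_cst (g (u n) / f (u n)) hI.
apply: (le_trans (le_normr_oint (M := 16 * del / a) hJ xu xy _)); last first.
  rewrite addrK normrM (gtr0_norm a0).
  by have -> : 16 * del / a * (a * `|x|) = 16 * del * `|x| by field; rewrite gt_eqF.
move=> t t1 t2.
have At : A' <= t by apply: le_trans t1; rewrite le_min un yn.
have ft : 0 < f t by apply: f0; exact: le_trans At.
have /ltr_normlP[gt1 gt2] := gA' _ At.
have tu : `|t - u n| <= a * `|x|.
  have -> : a * `|x| = `|a * x| by rewrite normrM gtr0_norm.
  move: t1 t2; rewrite /Num.min /Num.max.
  case: ifP => H t1 t2.
    rewrite !ger0_norm; lra.
  move/negbT: H; rewrite -leNgt => H.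
  rewrite !ler0_norm; lra.
have ftu : `|f t - f (u n)| <= del * f (u n).
  apply: (le_trans (lipA' _ _ un At)).
  apply: (@le_trans _ _ (del' * (2 * f (u n) * (`|x| + 1)))).
    apply: ler_wpM2l; first exact: ltW.
    apply: (le_trans tu); apply: ler_pM => //; [exact: ltW|by rewrite lerDl].
  rewrite le_eqVlt; apply/orP; left; apply/eqP; rewrite /del'.
  by field; rewrite gt_eqF.
have /ler_normlP[ftu1 ftu2] := ftu.
have -> : g t / f t - g (u n) / f (u n) =
   (g t * f (u n) - g (u n) * f t) / (g (u n) * f t) / a.
  by rewrite /a; field; rewrite !gt_eqF.
rewrite normrM (gtr0_norm (x := a^-1)) ?invr_gt0//.
apply: ler_wpM2r; first by rewrite invr_ge0 ltW.
have gf : 0 < g (u n) * f t by rewrite mulr_gt0.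
rewrite normrM normfV (gtr0_norm gf) ler_pdivrMr//.
have lowf : 2^-1 * f (u n) <= f t by nra.
have lowgf : 4^-1 * f (u n) <= g (u n) * f t by nra.
apply: (@le_trans _ _ (4 * del * f (u n))); last by nra.
have -> : g t * f (u n) - g (u n) * f t =
  (g t - g (u n)) * f (u n) - g (u n) * (f t - f (u n)) by ring.
apply: (le_trans (ler_normB _ _)); rewrite !normrM (gtr0_norm fu) (gtr0_norm gu0).
have : `|g t - g (u n)| <= 2 * del by rewrite ler_norml; apply/andP; split; lra.
nra.
Unshelve. all: by end_near. Qed.

(** * The normalized tail *)

(** The tail 1 - F(b_n) = 1/n tends to 0, whereas F never reaches 1: no A can
    bound b_n infinitely often, as 1 - F(A) > 0. *)
Lemma quantile_cvg_pinfty (R : realType) (F : R -> R) (b : R^nat) :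
  nondecreasing F -> (forall x, F x < 1) ->
  (\forall n \near \oo, 1 - F (b n) = n%:R^-1) ->
  b n @[n --> \oo] --> +oo.
Proof.
move=> Fnd F1 hb; apply/cvgryPgt => A.
have FA : 0 < 1 - F A by rewrite subr_gt0.
near=> n.
have bn : 1 - F (b n) = n%:R^-1 by near: n.
have nA : (1 - F A)^-1 < n%:R by near: n; exact: (cvgry_gt cvgr_idn).
have n0 : 0 < n%:R :> R by apply: lt_trans nA; rewrite invr_gt0.
rewrite ltNge; apply/negP => /Fnd bA.
have : 1 - F A <= n%:R^-1 by rewrite -bn lerB.
by rewrite leNgt => /negP; apply; rewrite invf_plt ?posrE.
Unshelve. all: by end_near. Qed.

Lemma gamma_cvg (R : realType) (x0 : R) (f f' g c : R -> R) (c_lim x : R) (b : R^nat) :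
  abs_continuous_with_density x0 f f' -> f' x @[x --> +oo] --> (0 : R) ->
  (forall x, x0 <= x -> 0 < f x) -> g x @[x --> +oo] --> (1 : R) ->
  0 < c_lim -> c x @[x --> +oo] --> c_lim ->
  locally_integrable_from x0 (fun t => g t / f t) ->
  b n @[n --> \oo] --> +oo ->
  gamma_ c (fun t => g t / f t) (fun n => f (b n) / g (b n)) b n x @[n --> \oo] --> x.
Proof.
move=> fac f'0 f0 g1 cl0 ccl hI by_.
have H := hazard_increment_cvg0 x fac f'0 f0 g1 hI by_.
have yy := normalization_cvg_pinfty x fac f'0 f0 g1 by_.
have cb : c (b n) @[n --> \oo] --> c_lim by apply: (cvg_comp _ _ by_ ccl).
have cy : c (f (b n) / g (b n) * x + b n) @[n --> \oo] --> c_lim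
  by apply: (cvg_comp _ _ yy ccl).
have L : ln (c (f (b n) / g (b n) * x + b n) / c (b n)) @[n --> \oo] --> (0 : R).
  rewrite -(@ln1 R).
  have q : c (f (b n) / g (b n) * x + b n) / c (b n) @[n --> \oo] --> (1 : R).
    have c0 : c_lim != 0 by rewrite gt_eqF.
    by rewrite -(divff c0); apply: cvgM cy _; apply: cvgV.
  by apply: (cvg_comp _ _ q); apply: continuous_ln; exact: ltr01.
rewrite -[X in _ --> X]add0r -[X in _ --> X + _](subr0 0).
by apply: cvgD; [apply: cvgB H L|exact: cvg_cst].
Qed.

(** The representation turns (1 - F(y)) / (1 - F(b_n)) into c(y) / c(b_n) times
    exp(- \int_{b_n}^y h). The constant h(b_n) subtracted inside gamma_n
    integrates to exactly x, because y - b_n = x / h(b_n), and cancels the x added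
    at the end of gamma_n. *)
Lemma tail_ratio_gamma (R : realType) (F : R -> R) (x0 x : R)
    (f g c : R -> R) (b : R^nat) (n : nat) :
  let y := f (b n) / g (b n) * x + b n in
  tail_representation F x0 c (fun t => g t / f t) ->
  (forall x, F x < 1) -> x0 <= b n -> x0 <= y -> f (b n) != 0 -> g (b n) != 0 ->
  1 - F y = (1 - F (b n)) *
    expR (- gamma_ c (fun t => g t / f t) (fun n => f (b n) / g (b n)) b n x).
Proof.
move=> y [hI rep] F1 xb xy fb gb.
(* As F < 1 the tail is positive, and c has its sign. *)
have c0 z : x0 <= z -> 0 < c z.
  move=> xz; have : 0 < 1 - F z by rewrite subr_gt0.
  by rewrite rep// pmulr_lgt0 ?expR_gt0.
rewrite /gamma_ -/y (oint_subr_cst _ hI)// (oint_chasles hI xb xy).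
have -> : g (b n) / f (b n) * (y - b n) = x by rewrite /y; field; rewrite fb gb.
rewrite !rep// -mulrA -expRD.
set I := oint x0 y _; set J := oint x0 (b n) _.
have -> : - J - (I - J - x - ln (c y / c (b n)) + x) = ln (c y / c (b n)) - I.
  by ring.
rewrite expRD lnK ?posrE ?divr_gt0 ?c0//.
by rewrite mulrA [c y / _]mulrC mulrA divff ?mul1r// gt_eqF ?c0.
Qed.

(** * The expansion *)

(** Only two facts on gamma_n matter here: it converges to x, and exp(- gamma_n)
    is n times the tail at the threshold. The remainder rho_n is the error made in
    replacing (1 - exp(- gamma_n) / n)^n by the Gumbel value at gamma_n. *)
Lemma gumbel_expansion_of_gamma (R : realType) (d : measure_display)
  (T : measurableType d)
  (P : probability T R) (X : nat -> {RV P >-> R}) (F : R -> R) (a b : R^nat)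
  (gam : nat -> R -> R) (x : R) :
  iid_with_df X F ->
  gam n x @[n --> \oo] --> x ->
  (\forall n \near \oo, F (a n * x + b n) = 1 - expR (- gam n x) / n%:R) ->
  gumbel_expansion X a b gam x.
Proof.
move=> hX gx Fg.
pose L (t : R) := expR (- expR (- t)).
have L0 : expR (- expR (- x)) * expR (- x) != 0 by rewrite mulf_neq0// gt_eqF// expR_gt0.
have [eps eps_o epsE] := first_order_expansion (is_derive_gumbel x) L0 gx.
pose rho n := F (a n * x + b n) ^+ n - L (gam n x).
exists eps, rho; split=> //; last first.
  near=> n; have n0 : (0 < n)%N by near: n; exact: nbhs_infty_gt.
  by rewrite (measure_running_max_le _ hX n0) -epsE /rho /L; ring.
have tx : expR (- gam n x) @[n --> \oo] --> expR (- x).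
  apply: (cvg_comp _ _ (cvgN gx)); exact: continuous_expR.
apply/eqOP; near=> k; near=> n.
have n0 : (0 < n)%N by near: n; exact: nbhs_infty_gt.
have nR : 0 < n%:R :> R by rewrite ltr0n.
have t1 : expR (- gam n x) < expR (- x) + 1.
  by near: n; apply: (cvgr_lt _ tx); rewrite ltrDl.
have tn : expR (- x) + 1 <= n%:R by near: n; exact: (cvgry_ge cvgr_idn).
have t0 := expR_gt0 (- gam n x).
have k1 : (expR (- x) + 1) ^+ 2 <= k by near: k; apply: nbhs_pinfty_ge; exact: num_real.
rewrite /rho; have -> : F (a n * x + b n) = 1 - expR (- gam n x) / n%:R by near: n.
apply: (le_trans (normr_onem_divX_expRN n0 _)).
  by rewrite ltW//= (le_trans _ tn)// ltW.
rewrite (gtr0_norm (x := n%:R^-1)) ?invr_gt0//.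
apply: ler_wpM2r; first by rewrite invr_ge0 ltW.
apply: le_trans k1; rewrite lerXn2r// ?nnegrE; lra.
Unshelve. all: by end_near. Qed.

Lemma gumbel_expansion_von_mises (R : realType) (d : measure_display)
  (T : measurableType d)
  (P : probability T R) (X : nat -> {RV P >-> R})
  (F : R -> R) (x0 : R) (f f' g c : R -> R) (c_lim : R) (b : R^nat) (x : R) :
  nondecreasing F -> (forall x, F x < 1) ->
  (forall x, x0 <= x -> 0 < f x) ->
  abs_continuous_with_density x0 f f' -> f' x @[x --> +oo] --> (0 : R) ->
  0 < c_lim -> c x @[x --> +oo] --> c_lim ->
  iid_with_df X F ->
  (\forall n \near \oo, 1 - F (b n) = n%:R^-1) ->
  g x @[x --> +oo] --> (1 : R) ->
  tail_representation F x0 c (fun t => g t / f t) ->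
  let a n := f (b n) / g (b n) in
  gumbel_expansion X a b (gamma_ c (fun t => g t / f t) a b) x.
Proof.
move=> Fnd F1 f0 fac f'0 cl0 ccl hX hb g1 rep a.
have by_ := quantile_cvg_pinfty Fnd F1 hb.
have yy := normalization_cvg_pinfty x fac f'0 f0 g1 by_.
apply: (gumbel_expansion_of_gamma hX).
  exact: gamma_cvg fac f'0 f0 g1 cl0 ccl rep.1 by_.
have gu : g (b n) @[n --> \oo] --> (1 : R) by apply: (cvg_comp _ _ by_ g1).
near=> n.
have xb : x0 <= b n by near: n; exact: (cvgry_ge by_).
have xy : x0 <= a n * x + b n by near: n; exact: (cvgry_ge yy).
have g0 : 0 < g (b n) by near: n; exact: (cvgr_gt _ gu).
have bn : 1 - F (b n) = n%:R^-1 by near: n.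
have := tail_ratio_gamma rep F1 xb xy.
rewrite bn !gt_eqF ?f0// => /(_ isT isT) E.
by rewrite [_ / n%:R]mulrC -E subKr.
Unshelve. all: by end_near. Qed.

Theorem corollary1 (R : realType) (d : measure_display) (T : measurableType d)
  (P : probability T R) (X : nat -> {RV P >-> R})
  (F : cumulativeBounded (0 : R) (1 : R))
  (x0 : R) (f f' c : R -> R) (c_lim : R)
  (b : R^nat) (b_def : forall n, b n = ginv F (1 - n%:R^-1))
  (hF : forall x, F x < 1)
  (hx0 : 0 <= x0)
  (f_gt0 : forall x, x0 <= x -> 0 < f x)
  (f_ac : abs_continuous_with_density x0 f f')
  (f'_cvg0 : f' x @[x --> +oo] --> (0 : R))
  (c_lim_gt0 : 0 < c_lim)
  (c_cvg : c x @[x --> +oo] --> c_lim)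
  (hX : iid_with_df X F)
  (hb : \forall n \near \oo, 1 - F (b n) = n%:R^-1) :
  (tail_representation F x0 c (fun t => 1 / f t) ->
     let a n := f (b n) in
     forall x : R, gumbel_expansion X a b
       (gamma_ c (fun t => 1 / f t) a b) x)
  /\
  (forall g : R -> R,
     g x @[x --> +oo] --> (1 : R) ->
     tail_representation F x0 c (fun t => g t / f t) ->
     let a n := f (b n) / g (b n) in
     forall x : R, gumbel_expansion X a b
       (gamma_ c (fun t => g t / f t) a b) x).
Proof.
have expansion g x := gumbel_expansion_von_mises x
  (@cumulative_is_nondecreasing _ _ _ F) hF f_gt0 f_ac f'_cvg0 c_lim_gt0 c_cvg
  hX hb (g := g).
split=> [rep a x|g g1 rep a x]; last exact: expansion.
have -> : a = (fun n => f (b n) / 1) by apply/funext => n; rewrite divr1.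
by apply: (expansion (cst 1)) => //; exact: cvg_cst.
Qed.
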